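(* Let $R=\mathbb{Z}[u,v,w,x,y,z]$ be the polynomial ring over the integers in six indeterminates, let $\Delta_1=vz-wy$, $\Delta_2=wx-uz$, $\Delta_3=uy-vx$, and let $\mathfrak{a}=(\Delta_1,\Delta_2,\Delta_3)R$. For every prime integer $p$ and every $q=p^e$ with $e$ a positive integer, let $$\lambda_q=\frac{(u\Delta_1)^q+(v\Delta_2)^q+(w\Delta_3)^q}{p}\in R .$$ Then the element $$\eta_q=\big[\lambda_q+(\Delta_1^q,\Delta_2^q,\Delta_3^q)R\big]\in H^3_{\mathfrak{a}}(R)$$ is zero. More specifically, with $k=q-1$, $$\lambda_q(\Delta_1\Delta_2\Delta_3)^{k}\in(\Delta_1^{q+k},\Delta_2^{q+k},\Delta_3^{q+k})R .$$ (Consequently, Hochster's conjecture, which in equivalent form asserts that for every prime integer $p$ there is some $q=p^e$ such that $\eta_q$ is a nonzero $p$-torsion element of $H^3_{\mathfrak{a}}(R)$, is false.)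
   Context: The elements $\Delta_1,\Delta_2,\Delta_3$ are, up to sign, the $2\times 2$ minors of the matrix $\begin{pmatrix} u & v & w \\ x & y & z \end{pmatrix}$. They satisfy $u\Delta_1+v\Delta_2+w\Delta_3=0$, so $(u\Delta_1)^q+(v\Delta_2)^q+(w\Delta_3)^q$ is divisible by $p$ in $R$ and $\lambda_q$ is a well-defined element of $R$. $H^3_{\mathfrak{a}}(R)$ denotes the third local cohomology module of $R$ with support in $\mathfrak{a}$, identified with the direct limit $$H^3_{\mathfrak{a}}(R)=\varinjlim_k \frac{R}{(\Delta_1^k,\Delta_2^k,\Delta_3^k)R},$$ where the maps in the direct system are induced by multiplication by $\Delta_1\Delta_2\Delta_3$. The notation $[r+(\Delta_1^k,\Delta_2^k,\Delta_3^k)R]$ denotes the image in the direct limit of the class of $r\in R$ in $R/(\Delta_1^k,\Delta_2^k,\Delta_3^k)R$. *)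

(* Defs.v *)
From HB Require Import structures.
From mathcomp Require Import all_boot all_order all_algebra.
From mathcomp Require Import generic_quotient ring_quotient.
From mathcomp Require Import boolp.
From mathcomp Require Import mpoly.
From mathcomp Require Import ring.

Set Implicit Arguments.
Unset Strict Implicit.
Unset Printing Implicit Defensive.

Import GRing.Theory.
Local Open Scope ring_scope.
Local Open Scope quotient_scope.

Definition ideal3 (R : comNzRingType) (a b c : R) : {pred R} :=
  fun x => `[< exists s t r : R, x = s * a + t * b + r * c >].

Section Ideal3.
Variables (R : comNzRingType) (a b c : R).

Lemma ideal3P x :
  reflect (exists s t r : R, x = s * a + t * b + r * c) (x \in ideal3 a b c).
Proof. exact: asboolP. Qed.

Lemma ideal3_zmod_closed : zmod_closed (ideal3 a b c).
Proof.
split; first by apply/ideal3P; exists 0, 0, 0; rewrite !mul0r !addr0.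
move=> x y /ideal3P[s [t [r ->]]] /ideal3P[s' [t' [r' ->]]].
apply/ideal3P; exists (s - s'), (t - t'), (r - r').
by rewrite !mulrBl !opprD addrACA; congr (_ + _); rewrite addrACA.
Qed.

HB.instance Definition _ :=
  GRing.isZmodClosed.Build R (ideal3 a b c) ideal3_zmod_closed.

Lemma ideal3M d x : x \in ideal3 a b c -> d * x \in ideal3 a b c.
Proof.
move=> /ideal3P[s [t [r ->]]]; apply/ideal3P.
by exists (d * s), (d * t), (d * r); rewrite !mulrDr !mulrA.
Qed.

(* The quotient R-module R / (a, b, c).  The ideal may be all of R, so the
   quotient ring {ideal_quot _}, which requires a proper ideal, does not apply. *)
Definition quot3 : Type := Quotient.quot (ideal3 a b c).

HB.instance Definition _ := GRing.Zmodule.on quot3.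
HB.instance Definition _ := Quotient.on quot3.

Definition cls3 (x : R) : quot3 := \pi_quot3 x.

Definition rep3 (x : quot3) : R := repr x.

Lemma cls3_rep (x : quot3) : cls3 (rep3 x) = x.
Proof. exact: reprK. Qed.

Lemma eq_cls3 x y : (cls3 x = cls3 y) <-> (x - y \in ideal3 a b c).
Proof. by rewrite Quotient.idealrBE; split=> /eqP. Qed.

Lemma cls3D x y : cls3 (x + y) = cls3 x + cls3 y.
Proof. exact: (@Quotient.pi_add _ (ideal3 a b c)). Qed.

Lemma cls30 : cls3 0 = 0.
Proof. by apply: (addrI (cls3 0)); rewrite -cls3D !addr0. Qed.

Definition scale3 (d : R) (x : quot3) : quot3 := cls3 (d * rep3 x).

Lemma scale3_cls d x : scale3 d (cls3 x) = cls3 (d * x).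
Proof. by apply/eq_cls3; rewrite -mulrBr ideal3M //; apply/eq_cls3/cls3_rep. Qed.

Lemma scale3A d e x : scale3 d (scale3 e x) = scale3 (d * e) x.
Proof. by rewrite -[x]cls3_rep !scale3_cls mulrA. Qed.

Lemma scale31 : left_id 1 scale3.
Proof. by move=> x; rewrite -[x]cls3_rep scale3_cls mul1r. Qed.

Lemma scale3Dr : right_distributive scale3 +%R.
Proof.
move=> d x y; rewrite -[x]cls3_rep -[y]cls3_rep.
by rewrite -cls3D !scale3_cls mulrDr cls3D.
Qed.

Lemma scale3Dl x : {morph scale3^~ x : d e / d + e}.
Proof.
by move=> d e /=; rewrite -[x]cls3_rep !scale3_cls mulrDl cls3D.
Qed.

HB.instance Definition _ := GRing.Zmodule_isLmodule.Build R quot3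
  scale3A scale31 scale3Dr scale3Dl.

Lemma cls3Z d x : d *: cls3 x = cls3 (d * x).
Proof. exact: scale3_cls. Qed.

End Ideal3.

(* Direct systems of R-modules indexed by (nat, <=). *)
Record dirsys (R : nzRingType) := DirSys {
  ds_obj :> nat -> lmodType R;
  ds_map : forall k l, (k <= l)%N -> {linear ds_obj k -> ds_obj l};
  ds_map_id : forall k (h : (k <= k)%N) x, ds_map h x = x;
  ds_map_comp : forall k l m (h : (k <= l)%N) (h' : (l <= m)%N)
    (h'' : (k <= m)%N) x, ds_map h' (ds_map h x) = ds_map h'' x
}.

Section DirectLimit.
Variables (R : nzRingType) (M : dirsys R).

Definition ds_elt := {k : nat & M k}.

Definition ds_in k (x : M k) : ds_elt := Tagged (fun k => M k : Type) x.

Definition ds_equiv (s t : ds_elt) : bool :=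
  `[< exists m (hs : (tag s <= m)%N) (ht : (tag t <= m)%N),
        ds_map M hs (tagged s) = ds_map M ht (tagged t) >].

Lemma ds_equiv_equiv : equiv_class_of ds_equiv.
Proof.
split=> [[k x]|[k x] [l y]|[l y] [k x] [m z]].
- by apply/asboolP; exists k, (leqnn k), (leqnn k).
- by apply/asboolP/asboolP => -[n [h [h' e]]]; exists n, h', h.
move=> /asboolP[/= n [h1 [h2 e]]] /asboolP[/= n' [h3 [h4 e']]].
have hn : (n <= maxn n n')%N by rewrite leq_maxl.
have hn' : (n' <= maxn n n')%N by rewrite leq_maxr.
apply/asboolP; exists (maxn n n'), (leq_trans h1 hn), (leq_trans h4 hn') => /=.
rewrite -(ds_map_comp h1 hn) e -(ds_map_comp h4 hn') -e'.
by rewrite (ds_map_comp _ _ (leq_trans h2 hn)) (ds_map_comp _ _ (leq_trans h2 hn)).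
Qed.

Canonical ds_equiv_equivRel := EquivRelPack ds_equiv_equiv.
Canonical ds_equiv_encModRel := defaultEncModRel ds_equiv.

Definition dlim : Type := {eq_quot ds_equiv}.

HB.instance Definition _ := Choice.on dlim.
HB.instance Definition _ := EqQuotient.on dlim.

Definition dlim_in k (x : M k) : dlim := \pi_dlim (ds_in x).

Lemma dlim_inP k l (x : M k) (y : M l) :
  dlim_in x = dlim_in y <->
  exists m (hk : (k <= m)%N) (hl : (l <= m)%N), ds_map M hk x = ds_map M hl y.
Proof.
split=> [/eqP|h]; first by rewrite piE => /asboolP.
by apply/eqP; rewrite piE; apply/asboolP.
Qed.

Lemma dlim_in_map k l (h : (k <= l)%N) (x : M k) :
  dlim_in (ds_map M h x) = dlim_in x.
Proof.
by apply/dlim_inP; exists l, (leqnn l), h; rewrite ds_map_id.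
Qed.

Lemma dlim_ind (P : dlim -> Prop) :
  (forall k (x : M k), P (dlim_in x)) -> forall s, P s.
Proof. by move=> h s; rewrite -[s]reprK; case: (repr s) => k x; apply: h. Qed.

Lemma dlim_in_ge n (s : dlim) : exists k (x : M k), (n <= k)%N /\ s = dlim_in x.
Proof.
elim/dlim_ind: s => k x; exists (maxn n k), (ds_map M (leq_maxr n k) x).
by rewrite leq_maxl dlim_in_map.
Qed.

Lemma dlim_in_common (s t : dlim) :
  exists k (x y : M k), s = dlim_in x /\ t = dlim_in y.
Proof.
elim/dlim_ind: s => k x; have [l [y [h ->]]] := dlim_in_ge k t.
by exists l, (ds_map M h x), y; rewrite dlim_in_map.
Qed.

Definition dlim_add (s t : dlim) : dlim :=
  let: existT k x := repr s in let: existT l y := repr t in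
  dlim_in (ds_map M (leq_maxl k l) x + ds_map M (leq_maxr k l) y).

Definition dlim_scale (a : R) (s : dlim) : dlim :=
  let: existT k x := repr s in dlim_in (a *: x).

Definition dlim_opp (s : dlim) : dlim := dlim_scale (-1) s.

Lemma dlim_addE k (x y : M k) :
  dlim_add (dlim_in x) (dlim_in y) = dlim_in (x + y).
Proof.
rewrite /dlim_add.
case ex: (repr (dlim_in x)) => [i x']; case ey: (repr (dlim_in y)) => [j y'].
have /dlim_inP[m [him [hkm exm]]] : dlim_in x' = dlim_in x.
  by rewrite -[RHS]reprK ex.
have /dlim_inP[n [hjn [hkn eyn]]] : dlim_in y' = dlim_in y.
  by rewrite -[RHS]reprK ey.
set N := maxn (maxn i j) (maxn m n).
have hmN : (m <= N)%N by rewrite /N !leq_max leqnn !orbT.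
have hnN : (n <= N)%N by rewrite /N !leq_max leqnn !orbT.
have hijN : (maxn i j <= N)%N by rewrite leq_maxl.
have hkN := leq_trans hkm hmN.
have Ex : ds_map M hijN (ds_map M (leq_maxl i j) x') = ds_map M hkN x.
  by rewrite (ds_map_comp _ _ (leq_trans him hmN)) -(ds_map_comp him hmN) exm ds_map_comp.
have Ey : ds_map M hijN (ds_map M (leq_maxr i j) y') = ds_map M hkN y.
  by rewrite (ds_map_comp _ _ (leq_trans hjn hnN)) -(ds_map_comp hjn hnN) eyn ds_map_comp.
by apply/dlim_inP; exists N, hijN, hkN; rewrite 2!raddfD; congr (_ + _).
Qed.

Lemma dlim_scaleE a k (x : M k) : dlim_scale a (dlim_in x) = dlim_in (a *: x).
Proof.
rewrite /dlim_scale; case ex: (repr (dlim_in x)) => [i x'].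
have /dlim_inP[m [him [hkm exm]]] : dlim_in x' = dlim_in x.
  by rewrite -[RHS]reprK ex.
by apply/dlim_inP; exists m, him, hkm; rewrite !linearZ /= exm.
Qed.

Lemma dlim_addC : commutative dlim_add.
Proof.
move=> s t; have [k [x [y [-> ->]]]] := dlim_in_common s t.
by rewrite !dlim_addE addrC.
Qed.

Lemma dlim_addA : associative dlim_add.
Proof.
move=> s t r; have [k [x [y [-> ->]]]] := dlim_in_common s t.
have [l [z [h ->]]] := dlim_in_ge k r.
by rewrite -(dlim_in_map h x) -(dlim_in_map h y) !dlim_addE addrA.
Qed.

Definition dlim_zero : dlim := dlim_in (0 : M 0%N).

Lemma dlim_zeroE k : dlim_in (0 : M k) = dlim_zero.
Proof. by rewrite -[RHS](dlim_in_map (leq0n k)) raddf0. Qed.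

Lemma dlim_add0 : left_id dlim_zero dlim_add.
Proof.
by elim/dlim_ind=> k x; rewrite -(dlim_zeroE k) dlim_addE add0r.
Qed.

Lemma dlim_addN : left_inverse dlim_zero dlim_opp dlim_add.
Proof.
elim/dlim_ind=> k x; rewrite /dlim_opp dlim_scaleE dlim_addE.
by rewrite scaleN1r addNr dlim_zeroE.
Qed.

HB.instance Definition _ :=
  GRing.isZmodule.Build dlim dlim_addA dlim_addC dlim_add0 dlim_addN.

Lemma dlim_inD k (x y : M k) : dlim_in (x + y) = dlim_in x + dlim_in y.
Proof. by rewrite -[LHS]dlim_addE. Qed.

Lemma dlim_scaleA a b s :
  dlim_scale a (dlim_scale b s) = dlim_scale (a * b) s.
Proof. by elim/dlim_ind: s => k x; rewrite !dlim_scaleE scalerA. Qed.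

Lemma dlim_scale1 : left_id 1 dlim_scale.
Proof. by elim/dlim_ind=> k x; rewrite !dlim_scaleE scale1r. Qed.

Lemma dlim_scaleDr : right_distributive dlim_scale +%R.
Proof.
move=> a s t; have [k [x [y [-> ->]]]] := dlim_in_common s t.
by rewrite -dlim_inD !dlim_scaleE scalerDr dlim_inD.
Qed.

Lemma dlim_scaleDl s : {morph dlim_scale^~ s : a b / a + b}.
Proof.
by move=> a b; elim/dlim_ind: s => k x; rewrite !dlim_scaleE scalerDl dlim_inD.
Qed.

HB.instance Definition _ := GRing.Zmodule_isLmodule.Build R dlim
  dlim_scaleA dlim_scale1 dlim_scaleDr dlim_scaleDl.

Lemma dlim_inZ a k (x : M k) : dlim_in (a *: x) = a *: dlim_in x.
Proof. by rewrite -[LHS]dlim_scaleE. Qed.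

End DirectLimit.

Section LocalCohomology.
Variables (R : comNzRingType) (f1 f2 f3 : R).

Definition lc3_obj (k : nat) : lmodType R :=
  quot3 (f1 ^+ k) (f2 ^+ k) (f3 ^+ k).

Definition lc3_cls (k : nat) (x : R) : lc3_obj k := cls3 _ _ _ x.

Definition lc3_fun k l (x : lc3_obj k) : lc3_obj l :=
  lc3_cls l ((f1 * f2 * f3) ^+ (l - k) * rep3 x).

Lemma lc3_funE k l (h : (k <= l)%N) (x : R) :
  lc3_fun l (lc3_cls k x) = lc3_cls l ((f1 * f2 * f3) ^+ (l - k) * x).
Proof.
apply/eq_cls3; rewrite -mulrBr.
set y := rep3 _.
have : cls3 (f1 ^+ k) (f2 ^+ k) (f3 ^+ k) y = cls3 (f1 ^+ k) (f2 ^+ k) (f3 ^+ k) x.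
  exact: (cls3_rep (cls3 (f1 ^+ k) (f2 ^+ k) (f3 ^+ k) x)).
move=> /eq_cls3/ideal3P[s [t [r ->]]]; apply/ideal3P.
rewrite -(subnK h); move: (l - k)%N => d; rewrite addnK.
exists (s * (f2 * f3) ^+ d), (t * (f1 * f3) ^+ d), (r * (f1 * f2) ^+ d).
by rewrite !exprMn !exprD; ring.
Qed.

Lemma lc3_clsP k (x : lc3_obj k) : exists y, x = lc3_cls k y.
Proof. by exists (rep3 x); rewrite /lc3_cls cls3_rep. Qed.

Lemma lc3_fun_linear k l (h : (k <= l)%N) : linear (@lc3_fun k l).
Proof.
move=> a x y; have [x' ->] := lc3_clsP x; have [y' ->] := lc3_clsP y.
rewrite /lc3_cls cls3Z -cls3D -!/(lc3_cls _ _) !lc3_funE //.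
by rewrite /lc3_cls cls3Z -cls3D; congr cls3; ring.
Qed.

Definition lc3_map k l (h : (k <= l)%N) : {linear lc3_obj k -> lc3_obj l} :=
  HB.pack (@lc3_fun k l)
    (GRing.isLinear.Build R (lc3_obj k) (lc3_obj l) *:%R _ (lc3_fun_linear h)).

Lemma lc3_mapE k l (h : (k <= l)%N) x :
  lc3_map h (lc3_cls k x) = lc3_cls l ((f1 * f2 * f3) ^+ (l - k) * x).
Proof. exact: lc3_funE. Qed.

Lemma lc3_map_id k (h : (k <= k)%N) x : lc3_map h x = x.
Proof. by have [y ->] := lc3_clsP x; rewrite lc3_mapE subnn mul1r. Qed.

Lemma lc3_map_comp k l m (h : (k <= l)%N) (h' : (l <= m)%N) (h'' : (k <= m)%N) x :
  lc3_map h' (lc3_map h x) = lc3_map h'' x.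
Proof.
have [y ->] := lc3_clsP x; rewrite !lc3_mapE mulrA -exprD.
by rewrite addnBA // subnK.
Qed.

Definition lc3_sys : dirsys R := DirSys lc3_map_id lc3_map_comp.

(* The third local cohomology module of R supported in (f1, f2, f3):
   the direct limit over k of R/(f1^k, f2^k, f3^k). *)
Definition lc3 : lmodType R := dlim lc3_sys.

(* The image in the limit of the class of x modulo (f1^k, f2^k, f3^k). *)
Definition lc3_in (k : nat) (x : R) : lc3 := @dlim_in R lc3_sys k (lc3_cls k x).

Lemma lc3_in_mul k l x : (k <= l)%N ->
  lc3_in l ((f1 * f2 * f3) ^+ (l - k) * x) = lc3_in k x.
Proof.
move=> h; rewrite -[RHS](@dlim_in_map R lc3_sys k l h) -[RHS]/(dlim_in _).
by congr dlim_in; rewrite -(lc3_mapE h).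
Qed.

Lemma lc3_in_eq0 k x :
  lc3_in k x = 0 <->
  exists l, (f1 * f2 * f3) ^+ l * x
    \in ideal3 (f1 ^+ (k + l)) (f2 ^+ (k + l)) (f3 ^+ (k + l)).
Proof.
split=> [|[l hl]].
  rewrite -[0](@dlim_zeroE R lc3_sys k) => /dlim_inP[m [h [h']]].
  rewrite raddf0 /= lc3_funE // => e; exists (m - k)%N; rewrite subnKC //.
  by move: e; rewrite -(cls30 (f1 ^+ m) (f2 ^+ m) (f3 ^+ m)) => /eq_cls3; rewrite subr0.
rewrite -(@lc3_in_mul k (k + l)) ?leq_addr // addKn.
rewrite -[RHS](@dlim_zeroE R lc3_sys (k + l)); congr dlim_in.
rewrite -[RHS](cls30 (f1 ^+ (k + l)) (f2 ^+ (k + l)) (f3 ^+ (k + l))).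
by apply/eq_cls3; rewrite subr0.
Qed.

End LocalCohomology.

Definition R6 : comNzRingType := {mpoly int[6]}.

Definition u_ : R6 := 'X_(inord 0 : 'I_6).
Definition v_ : R6 := 'X_(inord 1 : 'I_6).
Definition w_ : R6 := 'X_(inord 2 : 'I_6).
Definition x_ : R6 := 'X_(inord 3 : 'I_6).
Definition y_ : R6 := 'X_(inord 4 : 'I_6).
Definition z_ : R6 := 'X_(inord 5 : 'I_6).

Definition Delta1 : R6 := v_ * z_ - w_ * y_.
Definition Delta2 : R6 := w_ * x_ - u_ * z_.
Definition Delta3 : R6 := u_ * y_ - v_ * x_.

Definition power_sum (q : nat) : R6 :=
  (u_ * Delta1) ^+ q + (v_ * Delta2) ^+ q + (w_ * Delta3) ^+ q.

(* Coefficientwise quotient by p; it is the exact quotient when p divides f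
   (see lambdaP). *)
Definition mpoly_divz (n : nat) (f : {mpoly int[n]}) (p : int) : {mpoly int[n]} :=
  \sum_(m <- msupp f) (f@_m %/ p)%Z *: 'X_[m].

(* Meaningful when p divides power_sum q, in particular for q a positive power
   of the prime p. *)
Definition lambda (p q : nat) : R6 := mpoly_divz (power_sum q) p.

Lemma mpoly_divzK n (f : {mpoly int[n]}) (p : nat) :
  (forall m, (p %| f@_m)%Z) -> mpoly_divz f p *+ p = f.
Proof.
move=> hf; rewrite [RHS]mpolyE /mpoly_divz -sumrMnl; apply: eq_bigr => m _.
by rewrite scalerMnl -mulr_natr natz divzK.
Qed.

Lemma lambdaP p e : prime p -> lambda p (p ^ e) *+ p = power_sum (p ^ e).
Proof.
move=> pr; apply: mpoly_divzK => m.
have chp := pchar_Fp pr.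
rewrite (dvdz_pcharf chp) -mcoeff_map_mpoly.
have chP : p \in [pchar {mpoly 'F_p[6]}].
  by rewrite inE pr /= -mpolyC_nat; have /andP[_ /eqP ->] := chp; rewrite mpolyC0.
suff -> : map_mpoly (intr : int -> 'F_p) (power_sum (p ^ e)) = 0.
  by rewrite mcoeff0.
have h0 : u_ * Delta1 + v_ * Delta2 + w_ * Delta3 = 0.
  by rewrite /Delta1 /Delta2 /Delta3; ring.
rewrite !rmorphD !rmorphXn /=.
have FrD k (a b : {mpoly 'F_p[6]}) : (a + b) ^+ (p ^ k) = a ^+ (p ^ k) + b ^+ (p ^ k).
  elim: k a b => [|k IH] a b; first by rewrite expn0 !expr1.
  rewrite expnSr !exprM IH -!(pFrobenius_autE chP).
  exact: pFrobenius_autD_comm (mulrC _ _).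
by rewrite -!FrD -!rmorphD h0 rmorph0 expr0n gtn_eqF ?expn_gt0 ?prime_gt0.
Qed.

Definition eta (p q : nat) : lc3 Delta1 Delta2 Delta3 :=
  lc3_in Delta1 Delta2 Delta3 q (lambda p q).

Definition Hochster_conjecture : Prop :=
  forall p : nat, prime p -> exists e : nat,
    [/\ (0 < e)%N, eta p (p ^ e) <> 0 & eta p (p ^ e) *+ p = 0].

(* Main.v *)
(** The syzygies of Delta1^(2k+1), Delta2^(2k+1), Delta3^(2k+1) that make the
    sum divisible by p come from a residue theorem.  With L1 = u T + x,
    L2 = v T + y, L3 = w T + z, the differential T^k dT / (L1 L2 L3)^(k+1) has
    no residue at infinity, so its residues at the roots of L1, L2, L3 add up
    to zero; up to a common factor they are u^(k+1) Delta1^(2k+1) c1,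
    v^(k+1) Delta2^(2k+1) c2, w^(k+1) Delta3^(2k+1) c3, where
      c1 = sum_(m, n) 'C(k, m + n) (-x)^(m+n) 'C(k + m, m) 'C(k + n, n)
                      (-v)^m (-w)^n Delta3^(k-m) (-Delta2)^(k-n).
    When k = q - 1 with q a power of p, p divides 'C(k + m, m) for 0 < m <= k,
    so c1 is (-1)^k (Delta2 Delta3)^k modulo p.  The vanishing sum thus reads
    (-1)^k (Delta1 Delta2 Delta3)^k p lambda + p (element of the ideal) = 0,
    and p can be cancelled. *)

Require Import Defs.
From mathcomp Require Import all_boot all_order all_algebra.
From mathcomp Require Import mpoly ring.

Set Implicit Arguments.
Unset Strict Implicit.
Unset Printing Implicit Defensive.

Import GRing.Theory.
Local Open Scope ring_scope.

(** * Truncated negative binomial series *)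

(* Up to the factor d^(n+N+1), the truncation of (d - a X)^(-n-1) modulo X^(N+1). *)
Definition binomial_trunc (R : comNzRingType) (n N : nat) (a d : R) : {poly R} :=
  \poly_(m < N.+1) (a ^+ m * d ^+ (N - m) *+ 'C(n + m, m)).

(** Pascal's rule in degrees 1 to [N]; the truncation leaves one extra term, in degree [N.+1], and
    it supplies [r]. *)
Lemma mul_binomial_trunc (R : comNzRingType) n N (a d : R) :
  exists r, (d%:P - a%:P * 'X) * binomial_trunc n.+1 N a d =
     d%:P * binomial_trunc n N a d + 'X^(N.+1) * r.
Proof.
exists (- (a ^+ N.+1 *+ 'C(n.+1 + N, N)))%:P.
apply/polyP=> i; rewrite mulrBl -mulrA [X in _ = X]coefD [X in X = _]coefB.
rewrite !coefCM coefXM coefMC coefXn !coef_poly.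
case: i => [|i] /=; first by rewrite !addn0 !bin0 mul0r; ring.
rewrite !ltnS eqSS; case: (ltngtP i N) => [h|h|->] /=.
- rewrite mul0r addr0 [X in 'C(X, _)]addSn binS addSnnS mulrnDr.
  by rewrite -(subnSK h) !exprS; ring.
- by ring.
- by rewrite mul1r subnn !exprS; ring.
Qed.

Lemma binomial_trunc0 (R : comNzRingType) N (a d : R) :
  exists r, (d%:P - a%:P * 'X) * binomial_trunc 0 N a d =
     (d ^+ N.+1)%:P + 'X^(N.+1) * r.
Proof.
exists (- (a ^+ N.+1))%:P.
apply/polyP=> i; rewrite mulrBl -mulrA [X in _ = X]coefD [X in X = _]coefB.
rewrite !coefCM coefXM coefMC coefXn !coef_poly coefC.
case: i => [|i] /=; first by rewrite subn0 bin0 exprS; ring.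
rewrite !ltnS eqSS; case: (ltngtP i N) => [h|h|->] /=.
- by rewrite !add0n !binn -(subnSK h) !exprS; ring.
- by ring.
- by rewrite subnn add0n binn !exprS; ring.
Qed.

Lemma exp_mul_binomial_trunc (R : comNzRingType) n N (a d : R) :
  exists r, (d%:P - a%:P * 'X) ^+ n.+1 * binomial_trunc n N a d =
     (d ^+ (N + n.+1))%:P + 'X^(N.+1) * r.
Proof.
elim: n => [|n [r IH]].
  by have [r ->] := binomial_trunc0 N a d; exists r; rewrite addn1.
have [s e] := mul_binomial_trunc n N a d.
exists (d%:P * r + (d%:P - a%:P * 'X) ^+ n.+1 * s).
rewrite exprSr -mulrA e mulrDr mulrCA IH (addnS N n.+1) (exprS d (N + n.+1)) polyCM; ring.
Qed.

(** * Top coefficients of products and powers *)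

Lemma coefM_top (R : nzRingType) (p q : {poly R}) i j :
  (size p <= i.+1)%N -> (size q <= j.+1)%N -> (p * q)`_(i + j) = p`_i * q`_j.
Proof.
move=> hp hq; rewrite coefM.
rewrite (bigD1 (inord i)) //= inordK ?ltnS ?leq_addr // addKn big1 ?addr0 //.
move=> l; rewrite -val_eqE /= inordK ?ltnS ?leq_addr // => hl.
case: (ltngtP l i) hl => // h _; last by rewrite nth_default ?mul0r // (leq_trans hp).
rewrite [q`__]nth_default ?mulr0 // (leq_trans hq) //.
by rewrite ltn_subRL ltn_add2r.
Qed.

Lemma size_expr_deg1 (R : comNzRingType) (p : {poly R}) n :
  (size p <= 2)%N -> (size (p ^+ n) <= n.+1)%N.
Proof.
move=> h; apply: leq_trans (size_poly_exp_leq _ _) _.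
by rewrite ltnS -[X in (_ <= X)%N]mul1n leq_mul2r; case: (size p) h => [|[|[]]]; rewrite ?orbT.
Qed.

Lemma coef_expr_deg1 (R : comNzRingType) (p : {poly R}) n :
  (size p <= 2)%N -> (p ^+ n)`_n = p`_1 ^+ n.
Proof.
move=> h; elim: n => [|n IH]; first by rewrite !expr0 coef1.
by rewrite exprS -[n.+1]add1n coefM_top ?size_expr_deg1 // IH -exprS.
Qed.

(** * Expansion at a root, and its residue *)

Definition lin (R : comNzRingType) (u x : R) : {poly R} := u%:P * 'X + x%:P.

(* Expansion of T^k / (L2 L3)^(k+1) in powers of X = L1 = u T + x, up to units
   and modulo X^(k+1), via u T = X - x and u L2 = (u y - v x) + v X. *)
Definition principal (R : comNzRingType) k (u x v y w z : R) : {poly R} :=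
  ('X - x%:P) ^+ k * binomial_trunc k k (- v) (u * y - v * x) *
                     binomial_trunc k k (- w) (u * z - w * x).

Definition residue (R : comNzRingType) k (u x v y w z : R) : R :=
  (principal k u x v y w z)`_k.

Lemma size_lin (R : comNzRingType) (u x : R) : (size (lin u x) <= 2)%N.
Proof.
apply/leq_sizeP=> -[|[|j]] // _.
by rewrite /lin coefD coefCM coefX coefC mulr0 addr0.
Qed.

Lemma coef1_lin (R : comNzRingType) (u x : R) : (lin u x)`_1 = u.
Proof. by rewrite /lin coefD coefCM coefX coefC mulr1 addr0. Qed.

(** Only the term of degree [k] of the truncation reaches degree [k] after substitution. This turns
    a residue, a coefficient in the local variable, into a top coefficient in ['X]. *)
Lemma comp_lin_top (R : comNzRingType) (p q : {poly R}) k :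
  (size q <= 2)%N ->
  (size (take_poly k.+1 p \Po q) <= k.+1)%N /\
  (take_poly k.+1 p \Po q)`_k = p`_k * q`_1 ^+ k.
Proof.
move=> hq; rewrite /comp_poly (@horner_coef_wide _ k.+1); last first.
  by rewrite (leq_trans (size_poly _ _)) ?size_take_poly.
split.
  apply: (leq_trans (size_sum _ _ _)); apply/bigmax_leqP => i _.
  rewrite coef_map /= mul_polyC (leq_trans (size_scale_leq _ _)) //.
  by rewrite (leq_trans (size_expr_deg1 _ hq)).
rewrite coef_sum big_ord_recr /= big1 ?add0r => [|i _]; last first.
  rewrite coef_map /= coefCM [X in _ * X]nth_default ?mulr0 //.
  by rewrite (leq_trans (size_expr_deg1 _ hq)).
by rewrite coef_map /= coefCM coef_expr_deg1 // coef_take_poly ltnSn.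
Qed.

(** * The residue theorem over a field *)

Section ResidueTheorem.
Variable F : fieldType.
Implicit Types u v w x y z : F.

(** Local interpolation at the root of [lin u x]: substituting [lin u x] for ['X] in the congruences
    of the two truncated series recovers ['X^k] to order [k.+1], up to constants. *)
Lemma lin_dvd_principal k u x v y w z : u != 0 ->
  lin u x ^+ k.+1 %|
    u ^+ k.+2 *: ((take_poly k.+1 (principal k u x v y w z) \Po lin u x)
                  * (lin v y * lin w z) ^+ k.+1)
    - ((u * y - v * x) * (u * z - w * x)) ^+ k.*2.+1 *: 'X^k.
Proof.
move=> u0; set P := principal _ _ _ _ _ _ _; set L := lin u x.
set d := u * y - v * x; set d' := u * z - w * x.
have [r e] := exp_mul_binomial_trunc k k (- v) d.
have [r' e'] := exp_mul_binomial_trunc k k (- w) d'.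
have eL a b : (u * b - a * x)%:P - (- a)%:P * L = u%:P * lin a b.
  by rewrite /L /lin !polyCB !polyCM polyCN; ring.
have comp a b : ((u * b - a * x)%:P - (- a)%:P * 'X) \Po L = u%:P * lin a b.
  by rewrite -eL comp_polyB comp_polyM comp_polyC comp_polyC comp_polyX.
have [s E] : exists s, (u%:P * lin v y * (u%:P * lin w z)) ^+ k.+1 * (P \Po L)
   = ((d * d') ^+ k.*2.+1)%:P * (u%:P * 'X) ^+ k + L ^+ k.+1 * s.
  have [s E] : exists s, ((d%:P - (- v)%:P * 'X) * (d'%:P - (- w)%:P * 'X)) ^+ k.+1 * P
     = ((d * d') ^+ k.*2.+1)%:P * ('X - x%:P) ^+ k + 'X^(k.+1) * s.
    exists (('X - x%:P) ^+ k * ((d ^+ (k + k.+1))%:P * r' + r * (d' ^+ (k + k.+1))%:P + 'X^(k.+1) * r * r')).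
    rewrite /P /principal -/d -/d' exprMn.
    transitivity (('X - x%:P) ^+ k * ((d%:P - (- v)%:P * 'X) ^+ k.+1 * binomial_trunc k k (- v) d)
       * ((d'%:P - (- w)%:P * 'X) ^+ k.+1 * binomial_trunc k k (- w) d')); first by ring.
    by rewrite e e' addnS addnn exprMn polyCM; ring.
  exists (s \Po L); rewrite -!comp -comp_polyM -rmorphXn /= -comp_polyM E.
  rewrite comp_polyD !comp_polyM comp_polyC !rmorphXn /= comp_polyB comp_polyX comp_polyC.
  by rewrite /L /lin addrK.
rewrite -(@dvdpZr _ (u ^+ k)) ?expf_neq0 //.
set t := take_poly _ _ \Po L.
suff -> : u ^+ k *: (u ^+ k.+2 *: (t * (lin v y * lin w z) ^+ k.+1)
    - (d * d') ^+ k.*2.+1 *: 'X^k)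
  = L ^+ k.+1 * (s - (u%:P * lin v y * (u%:P * lin w z)) ^+ k.+1
                     * (drop_poly k.+1 P \Po L)) by exact: dvdp_mulr.
have {}E := canRL (addKr _) (esym E).
(* The terms of [P] beyond degree [k] become multiples of [L ^+ k.+1]. *)
have eP : P \Po L = t + (drop_poly k.+1 P \Po L) * L ^+ k.+1.
  by rewrite -{1}(poly_take_drop k.+1 P) comp_polyD comp_polyM comp_Xn_poly.
rewrite [RHS]mulrBr [X in _ = X - _]E eP.
rewrite -!mul_polyC !exprMn !polyC_exp !(exprS u%:P); ring.
Qed.

Lemma coprimep_lin u x v y : u * y - v * x != 0 ->
  coprimep (lin u x) (lin v y).
Proof.
move=> h; apply/Bezout_coprimepP; exists (- v%:P, u%:P) => /=.
have -> : - v%:P * lin u x + u%:P * lin v y = (u * y - v * x)%:P.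
  by rewrite /lin polyCB !polyCM; ring.
by rewrite -size_poly_eq1 size_polyC h.
Qed.

(** Degree count: [k] from the truncated part and [k.+1] from each of the two powers of linear
    forms; top coefficients multiply. *)
Lemma size_coef_term k u x v y w z (c : F) :
  let t := c *: ((take_poly k.+1 (principal k u x v y w z) \Po lin u x)
                  * (lin v y * lin w z) ^+ k.+1) in
  (size t <= (k + (k.+1 + k.+1)).+1)%N /\
  t`_(k + (k.+1 + k.+1)) =
    c * (residue k u x v y w z * u ^+ k * (v * w) ^+ k.+1).
Proof.
have [h1 h2] := comp_lin_top (principal k u x v y w z) k (size_lin u x).
have h3 n (a b : F) : (size (lin a b ^+ n) <= n.+1)%N by rewrite size_expr_deg1 ?size_lin.
have hM (p q : {poly F}) i j : (size p <= i.+1)%N -> (size q <= j.+1)%N ->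
    (size (p * q)%R <= (i + j).+1)%N.
  move=> hp hq; apply: leq_trans (size_polyMleq _ _) _.
  by have := leq_add hp hq; rewrite addSn addnS; case: (size p + size q)%N.
rewrite /= exprMn; split.
  by apply: leq_trans (size_scale_leq _ _) _; rewrite !hM.
by rewrite coefZ !coefM_top ?hM // h2 !coef_expr_deg1 ?size_lin // !coef1_lin exprMn.
Qed.

(* H is the Hermite interpolation error of T^k at the three roots: divisible by
   (L1 L2 L3)^(k+1), yet of smaller degree.  Its top coefficient is the sum. *)
Lemma residue_sum k u x v y w z :
  u != 0 -> v != 0 -> w != 0 ->
  v * z - w * y != 0 -> w * x - u * z != 0 -> u * y - v * x != 0 ->
  u ^+ k.+1 * (v * z - w * y) ^+ k.*2.+1 * residue k u x v y w z +
  v ^+ k.+1 * (w * x - u * z) ^+ k.*2.+1 * residue k v y w z u x +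
  w ^+ k.+1 * (u * y - v * x) ^+ k.*2.+1 * residue k w z u x v y = 0.
Proof.
move=> u0 v0 w0.
have h1 := lin_dvd_principal k x v y w z u0.
have h2 := lin_dvd_principal k y w z u x v0.
have h3 := lin_dvd_principal k z u x v y w0.
have e (a b c d : F) : a * b - c * d = - (c * d - a * b) by rewrite opprB.
rewrite (e u z) mulrN exprNn in h1; rewrite (e v x) mulrN exprNn in h2.
rewrite (e w y) mulrN exprNn in h3.
set N := k.*2.+1 in h1 h2 h3 *.
(* In each divisibility one minor appears with the opposite sign; as [N] is odd, the difference
   becomes a sum. *)
have sN : (-1) ^+ N = -1 :> F by rewrite /N -signr_odd /= odd_double.
rewrite sN mulN1r scaleNr opprK in h1; rewrite sN mulN1r scaleNr opprK in h2.
rewrite sN mulN1r scaleNr opprK in h3.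
move: h1 h2 h3.
set D1 := v * z - w * y; set D2 := w * x - u * z; set D3 := u * y - v * x.
move=> h1 h2 h3 D10 D20 D30.
have [s1 c1] := size_coef_term k u x v y w z (D1 ^+ N * u ^+ k.+2).
have [s2 c2] := size_coef_term k v y w z u x (D2 ^+ N * v ^+ k.+2).
have [s3 c3] := size_coef_term k w z u x v y (D3 ^+ N * w ^+ k.+2).
rewrite -!(scalerA (_ ^+ N)) in s1 s2 s3 c1 c2 c3.
set L1 := lin u x in h1 h2 h3 s1 s2 s3 c1 c2 c3.
set L2 := lin v y in h1 h2 h3 s1 s2 s3 c1 c2 c3.
set L3 := lin w z in h1 h2 h3 s1 s2 s3 c1 c2 c3.
set t1 := _ *: (_ * (L2 * L3) ^+ _) in h1 s1 c1.
set t2 := _ *: (_ * (L3 * L1) ^+ _) in h2 s2 c2.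
set t3 := _ *: (_ * (L1 * L2) ^+ _) in h3 s3 c3.
set M := (k + (k.+1 + k.+1))%N in s1 s2 s3 c1 c2 c3.
pose H := D1 ^+ N *: t1 + D2 ^+ N *: t2 + D3 ^+ N *: t3 + (D1 * D2 * D3) ^+ N *: 'X^k.
(* [h1] handles [t1] together with the ['X^k] term; [t2] and [t3] contain [L1 ^+ k.+1] as a
   factor. *)
have d1 : L1 ^+ k.+1 %| H.
  have -> : H = D1 ^+ N *: (t1 + (D3 * D2) ^+ N *: 'X^k) + (D2 ^+ N *: t2 + D3 ^+ N *: t3).
    by rewrite /H -!mul_polyC !exprMn !polyCM; ring.
  rewrite dvdp_add ?dvdpZr ?expf_neq0 ?h1 // dvdp_add ?dvdpZr ?expf_neq0 //.
    by rewrite !exprMn !dvdp_mull.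
  by rewrite exprMn dvdp_mull // dvdp_mulr.
have d2 : L2 ^+ k.+1 %| H.
  have -> : H = D2 ^+ N *: (t2 + (D1 * D3) ^+ N *: 'X^k) + (D1 ^+ N *: t1 + D3 ^+ N *: t3).
    by rewrite /H -!mul_polyC !exprMn !polyCM; ring.
  rewrite dvdp_add ?dvdpZr ?expf_neq0 ?h2 // dvdp_add ?dvdpZr ?expf_neq0 //.
    by rewrite exprMn dvdp_mull // dvdp_mulr.
  by rewrite !exprMn !dvdp_mull.
have d3 : L3 ^+ k.+1 %| H.
  have -> : H = D3 ^+ N *: (t3 + (D2 * D1) ^+ N *: 'X^k) + (D1 ^+ N *: t1 + D2 ^+ N *: t2).
    by rewrite /H -!mul_polyC !exprMn !polyCM; ring.
  rewrite dvdp_add ?dvdpZr ?expf_neq0 ?h3 // dvdp_add ?dvdpZr ?expf_neq0 //.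
    by rewrite !exprMn !dvdp_mull.
  by rewrite exprMn dvdp_mull // dvdp_mulr.
have kM : (k < M)%N by rewrite /M addSn addnS ltnS leq_addr.
have sH : (size H <= M.+1)%N.
  have sD (p q : {poly F}) : (size p <= M.+1)%N -> (size q <= M.+1)%N ->
      (size (p + q)%R <= M.+1)%N.
    by move=> hp hq; rewrite (leq_trans (size_polyD _ _)) // geq_max hp.
  apply: (sD); [by apply: (sD) => //; apply: (sD)|].
  by rewrite (leq_trans (size_scale_leq _ _)) // size_polyXn; apply: ltnW.
have s2L (a b : F) : a != 0 -> size (lin a b) = 2.
  by move=> a0; rewrite /lin size_MXaddC polyC_eq0 (negPf a0) /= size_polyC a0.
have nz (a b : F) : a != 0 -> lin a b ^+ k.+1 != 0.
  by move=> a0; rewrite expf_neq0 // -size_poly_gt0 s2L.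
have szL (a b : F) : a != 0 -> size (lin a b ^+ k.+1) = k.+2.
  by move=> a0; rewrite polySpred ?nz // size_exp s2L // mul1n.
have H0 : H = 0.
  apply/eqP/negPn/negP => Hn0.
  have : L1 ^+ k.+1 * (L2 ^+ k.+1 * L3 ^+ k.+1) %| H.
    have cX p q : coprimep p q -> coprimep (p ^+ k.+1) (q ^+ k.+1).
      by move=> pq; apply/coprimep_expl/coprimep_expr.
    rewrite !Gauss_dvdp ?d1 ?d2 ?d3 //; first exact/cX/coprimep_lin.
    rewrite coprimepMr !cX ?coprimep_lin //.
    by rewrite -oppr_eq0 opprB.
  (* The product of the three powers has degree [3k+3], whereas [H] has degree at most [M], that is
     [3k+2]. *)
  move=> /(dvdp_leq Hn0).
  rewrite !size_mul ?mulf_neq0 ?nz // !szL // => /leq_trans/(_ sH).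
  by rewrite /M /= ?(addSn, addnS) /= ?(addSn, addnS) /= ltnn.
have := congr1 (fun p : {poly F} => p`_M) H0.
rewrite /H !coefD coef0 c1 c2 c3 coefZ coefXn gtn_eqF // mulr0 addr0.
(* Each top coefficient carries the common factor [(u * v * w) ^+ k.+1], which is cancelled. *)
move=> E; apply/eqP; rewrite -(mulrI_eq0 _ (mulfI (expf_neq0 k.+1 (mulf_neq0 (mulf_neq0 u0 v0) w0)))).
by rewrite -E; apply/eqP; rewrite !exprMn !exprS; ring.
Qed.

End ResidueTheorem.

(** * Transfer to integral domains through the fraction field *)

Lemma map_binomial_trunc (R S : comNzRingType) (f : {rmorphism R -> S}) n N a d :
  map_poly f (binomial_trunc n N a d) = binomial_trunc n N (f a) (f d).
Proof.
apply/polyP=> i; rewrite coef_map !coef_poly; case: ifP => _; last exact: rmorph0.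
by rewrite /= rmorphMn rmorphM !rmorphXn.
Qed.

Lemma map_residue (R S : comNzRingType) (f : {rmorphism R -> S}) k u x v y w z :
  f (residue k u x v y w z) = residue k (f u) (f x) (f v) (f y) (f w) (f z).
Proof.
rewrite /residue -coef_map /principal !rmorphM rmorphXn /= !map_binomial_trunc.
by rewrite rmorphB /= map_polyX map_polyC !rmorphN !rmorphB !rmorphM.
Qed.

Lemma residue_sum_idomain (R : idomainType) k (u x v y w z : R) :
  u != 0 -> v != 0 -> w != 0 ->
  v * z - w * y != 0 -> w * x - u * z != 0 -> u * y - v * x != 0 ->
  u ^+ k.+1 * (v * z - w * y) ^+ k.*2.+1 * residue k u x v y w z +
  v ^+ k.+1 * (w * x - u * z) ^+ k.*2.+1 * residue k v y w z u x +
  w ^+ k.+1 * (u * y - v * x) ^+ k.*2.+1 * residue k w z u x v y = 0.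
Proof.
move=> u0 v0 w0 D1 D2 D3; apply/eqP; rewrite -tofrac_eq0.
rewrite !rmorphD /= !tofracM !tofracXn !tofracB !tofracM !map_residue.
by rewrite residue_sum // -?tofracM -?tofracB tofrac_eq0.
Qed.

(** * Residues modulo [p] *)

(** With [q = p ^ e], one has [m * 'C(q - 1 + m, m) = q * 'C(q - 1 + m, m - 1)]. If [p] did not
    divide the binomial, [q] would divide [m]. *)
Lemma prime_dvd_bin_pred_add p e m : prime p -> (0 < m < p ^ e)%N ->
  (p %| 'C((p ^ e).-1 + m, m))%N.
Proof.
move=> pr /andP[m0 mq]; apply/negPn/negP => ndiv.
have q0 : (0 < p ^ e)%N by rewrite expn_gt0 prime_gt0.
have : (p ^ e %| m)%N.
  rewrite -(@Gauss_dvdl _ _ 'C((p ^ e).-1 + m, m)); last first.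
    by rewrite coprimeXl // prime_coprime.
  case: m m0 {mq ndiv} => // m _.
  by rewrite mul_bin_left addnS -addSn prednK // addnK dvdn_mulr.
by move=> /(dvdn_leq m0); rewrite leqNgt mq.
Qed.

Lemma binomial_trunc_mod (R : comNzRingType) p k (a d : R) :
  (forall m, (0 < m <= k)%N -> (p %| 'C(k + m, m))%N) ->
  exists r, binomial_trunc k k a d = (d ^+ k)%:P + r *+ p.
Proof.
move=> hp.
exists (\poly_(m < k.+1) if m == 0%N then 0
        else a ^+ m * d ^+ (k - m) *+ ('C(k + m, m) %/ p)).
apply/polyP=> i; rewrite coefD coefMn coefC !coef_poly ltnS.
case: i => [|i] /=; first by rewrite subn0 bin0 mul0rn addr0 mul1r.
case: ifP => h; last by rewrite mul0rn addr0.
by rewrite add0r -mulrnA divnK // hp.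
Qed.

(** Modulo [p] both series reduce to their constant terms, and the coefficient of degree [k] in
    [('X - x%:P) ^+ k] is 1. *)
Lemma residue_mod (R : comNzRingType) p k (u x v y w z : R) :
  (forall m, (0 < m <= k)%N -> (p %| 'C(k + m, m))%N) ->
  exists r, residue k u x v y w z =
    ((u * y - v * x) * (u * z - w * x)) ^+ k + r *+ p.
Proof.
move=> hp; rewrite /residue /principal.
have [r ->] := binomial_trunc_mod (- v) (u * y - v * x) hp.
have [s ->] := binomial_trunc_mod (- w) (u * z - w * x) hp.
set d := _ - v * x; set d' := _ - w * x.
exists (('X - x%:P) ^+ k * ((d ^+ k)%:P * s + r * (d' ^+ k)%:P + r * s *+ p))`_k.
have -> : ('X - x%:P) ^+ k * ((d ^+ k)%:P + r *+ p) * ((d' ^+ k)%:P + s *+ p)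
  = ((d * d') ^+ k)%:P * ('X - x%:P) ^+ k
    + (('X - x%:P) ^+ k * ((d ^+ k)%:P * s + r * (d' ^+ k)%:P + r * s *+ p)) *+ p.
  by rewrite exprMn polyCM; ring.
rewrite coefD coefMn coefCM coef_expr_deg1 ?size_XsubC //.
by rewrite coefB coefX coefC subr0 expr1n mulr1.
Qed.

(** * Application to the generic matrix *)

Lemma meval_neq0 (f : {mpoly int[6]}) (e : 'I_6 -> int) : f.@[e] != 0 -> f != 0.
Proof. by apply: contraNneq => ->; rewrite meval0. Qed.

Lemma indeterminates_neq0 :
  [/\ u_ != 0, v_ != 0, w_ != 0, Delta1 != 0 & Delta2 != 0 /\ Delta3 != 0].
Proof.
split; last split.
- by apply: (@meval_neq0 _ (fun=> 1)); rewrite mevalXU.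
- by apply: (@meval_neq0 _ (fun=> 1)); rewrite mevalXU.
- by apply: (@meval_neq0 _ (fun=> 1)); rewrite mevalXU.
(* Setting [v_] and [z_] to 1 and the rest to 0 gives [Delta1] the value 1; the other minors are
   treated alike. *)
- apply: (@meval_neq0 _ (fun i => (nat_of_ord i \in [:: 1; 5]%N)%:R)).
  by rewrite mevalB !mevalM !mevalXU !inordK.
- apply: (@meval_neq0 _ (fun i => (nat_of_ord i \in [:: 2; 3]%N)%:R)).
  by rewrite mevalB !mevalM !mevalXU !inordK.
- apply: (@meval_neq0 _ (fun i => (nat_of_ord i \in [:: 0; 4]%N)%:R)).
  by rewrite mevalB !mevalM !mevalXU !inordK.
Qed.

(** The parts of the residues prime to the corrections [r1], [r2], [r3] add up to the power sum
    times [(-1) ^+ k * (D1 * D2 * D3) ^+ k], so [p] factors out of the whole sum. *)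
Lemma scaled_syzygyE (R : comNzRingType) (u v w D1 D2 D3 r1 r2 r3 l : R) p q k :
  (u * D1) ^+ q + (v * D2) ^+ q + (w * D3) ^+ q = l *+ p ->
  p%:R * ((-1) ^+ k * (l * (D1 * D2 * D3) ^+ k) +
    (u ^+ q * r1 * D1 ^+ (q + k) + v ^+ q * r2 * D2 ^+ (q + k)
     + w ^+ q * r3 * D3 ^+ (q + k))) =
  u ^+ q * D1 ^+ (q + k) * ((D3 * - D2) ^+ k + r1 *+ p) +
  v ^+ q * D2 ^+ (q + k) * ((D1 * - D3) ^+ k + r2 *+ p) +
  w ^+ q * D3 ^+ (q + k) * ((D2 * - D1) ^+ k + r3 *+ p).
Proof.
move=> pl; rewrite mulrDr (mulrCA p%:R) (mulrA p%:R) mulr_natl -pl.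
rewrite -(mulr_natl r1) -(mulr_natl r2) -(mulr_natl r3) !mulrN.
rewrite (exprNn (D3 * _)) (exprNn (D1 * _)) (exprNn (D2 * _)) !exprMn !exprD; ring.
Qed.

Lemma lambda_mem p e : prime p ->
  lambda p (p ^ e) * (Delta1 * Delta2 * Delta3) ^+ (p ^ e - 1)
    \in ideal3 (Delta1 ^+ (p ^ e + (p ^ e - 1)))
               (Delta2 ^+ (p ^ e + (p ^ e - 1))) (Delta3 ^+ (p ^ e + (p ^ e - 1))).
Proof.
move=> pr; set q := (p ^ e)%N; set k := (q - 1)%N.
have q0 : (0 < q)%N by rewrite expn_gt0 prime_gt0.
have kq : k.+1 = q by rewrite /k subn1 prednK.
have hp m : (0 < m <= k)%N -> (p %| 'C(k + m, m))%N.
  by move=> h; rewrite /k subn1 prime_dvd_bin_pred_add // -/q -kq.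
have [u0 v0 w0 D1 [D2 D3]] := indeterminates_neq0.
have S := @residue_sum_idomain {mpoly int[6]} k u_ x_ v_ y_ w_ z_ u0 v0 w0 D1 D2 D3.
have [r1 e1] := residue_mod u_ x_ v_ y_ w_ z_ hp.
have [r2 e2] := residue_mod v_ y_ w_ z_ u_ x_ hp.
have [r3 e3] := residue_mod w_ z_ u_ x_ v_ y_ hp.
have pl : power_sum q = lambda p q *+ p by rewrite lambdaP.
have p0 : (p%:R : {mpoly int[6]}) != 0.
  by rewrite -mpolyC_nat mpolyC_eq0 Num.Theory.pnatr_eq0 -lt0n prime_gt0.
pose s := (-1) ^+ k : R6.
have E : s * (lambda p q * (Delta1 * Delta2 * Delta3) ^+ k) =
   - (u_ ^+ q * r1 * Delta1 ^+ (q + k) + v_ ^+ q * r2 * Delta2 ^+ (q + k)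
      + w_ ^+ q * r3 * Delta3 ^+ (q + k)).
  (* [p] is cancelled in a domain of characteristic zero; then [k.+1 = q] turns the exponent
     [k.*2.+1] into [q + k]. *)
  apply/eqP; rewrite -addr_eq0; apply/eqP/(mulfI p0); rewrite mulr0 -[RHS]S.
  rewrite -addnn -addSn kq e1 e2 e3.
  rewrite -/Delta1 -/Delta2 -/Delta3.
  have -> : u_ * z_ - w_ * x_ = - Delta2 by rewrite opprB.
  have -> : v_ * x_ - u_ * y_ = - Delta3 by rewrite opprB.
  have -> : w_ * y_ - v_ * z_ = - Delta1 by rewrite opprB.
  exact: scaled_syzygyE.
(* The sign is its own inverse, so it moves to the other side. *)
have ss : s * s = 1 by rewrite /s -exprMn mulrNN mulr1 expr1n.
rewrite -[_ * _]mul1r -ss -mulrA E ideal3M // rpredN.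
by apply/ideal3P; do 3 eexists; reflexivity.
Qed.

Theorem mainTheorem1 :
  (forall p e : nat, prime p -> (0 < e)%N ->
    let q := (p ^ e)%N in
    let k := (q - 1)%N in
    eta p q = 0 /\
    lambda p q * (Delta1 * Delta2 * Delta3) ^+ k
      \in ideal3 (Delta1 ^+ (q + k)) (Delta2 ^+ (q + k)) (Delta3 ^+ (q + k)))
  /\ ~ Hochster_conjecture.
Proof.
have eta0 p e : prime p -> eta p (p ^ e) = 0.
  move=> pr; apply/lc3_in_eq0; exists (p ^ e - 1)%N.
  by rewrite mulrC; apply: lambda_mem.
split=> [p e pr _ q k|/(_ 2%N isT)[e [_ nz _]]].
  by split; [apply: eta0 | apply: lambda_mem].
exact/nz/eta0.
Qed.
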